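(* There is an algorithm that, given a temporal star $(G_s,L)$ on $n$ vertices in which every edge has at most $3$ labels and all labels are distinct (no integer is a label of two different edges, and the labels of each edge are distinct), decides in $O(n\log n)$ time whether $(G_s,L)$ is explorable (i.e.\ solves \textsc{StarExp(3)} on such instances).
   Context: A temporal graph is a pair $(G,L)$ where $G=(V,E)$ is a graph and $L:E\to 2^{\mathbb{N}}$ assigns to each edge a set of positive integer labels (the discrete times at which the edge is available). A temporal star is a temporal graph whose underlying graph $G_s$ is a star with center $c$ and $n-1$ leaves. A time edge is a triple $(u,v,l)$ with $\{u,v\}\in E$ and $l\in L(\{u,v\})$. A journey from $u$ to $v$ is a sequence of time edges $(u,u_1,l_1),(u_1,u_2,l_2),\dots,(u_{r-1},v,l_r)$ with $l_1<l_2<\dots<l_r$. The temporal star $(G_s,L)$ is explorable if there is a journey starting and ending at the center $c$ that visits every vertex of $G_s$. The decision problem \textsc{StarExp($k$)} takes as input a temporal star in which every edge has at most $k$ labels and asks whether it is explorable. *)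

(* Defs.v *)
From Stdlib Require Import ZArith.
From mathcomp Require Import all_boot.

Set Implicit Arguments.
Unset Strict Implicit.
Unset Printing Implicit Defensive.

(* A temporal star on n vertices is given by  S : seq (seq nat)  with   *)
(* size S = n - 1.  Vertex 0 is the center c; vertex i (1 <= i <= n-1) *)
(* is a leaf, and the edge {0,i} carries the label list  nth [::] S (i-1). *)

Definition star_nverts (S : seq (seq nat)) : nat := (size S).+1.

Definition edge_labels (S : seq (seq nat)) (i : nat) : seq nat :=
  nth [::] S i.-1.

Definition time_edge (S : seq (seq nat)) (e : nat * nat * nat) : bool :=
  let: (u, v, l) := e in
  [|| (u == 0) && (0 < v <= size S) && (l \in edge_labels S v)
    | (v == 0) && (0 < u <= size S) && (l \in edge_labels S u)].

Fixpoint journey_from (S : seq (seq nat)) (u v : nat) (prev : nat)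
  (J : seq (nat * nat * nat)) : bool :=
  match J with
  | [::] => u == v
  | (a, b, l) :: J' =>
      [&& time_edge S (a, b, l), a == u, prev < l & journey_from S b v l J']
  end.

(* labels are positive integers, so prev = 0 imposes no constraint *)
Definition is_journey (S : seq (seq nat)) (u v : nat) (J : seq (nat * nat * nat)) : bool :=
  journey_from S u v 0 J.

Definition visits (u : nat) (J : seq (nat * nat * nat)) (x : nat) : bool :=
  (x == u) || has (fun e : nat * nat * nat => (e.1.1 == x) || (e.1.2 == x)) J.

Definition explorable (S : seq (seq nat)) : Prop :=
  exists J, is_journey S 0 0 J /\ forall x, x < star_nverts S -> visits 0 J x.

Definition valid_instance3 (S : seq (seq nat)) : bool :=
  [&& all (fun s => size s <= 3) S,
      all (fun l => 0 < l) (flatten S) & uniq (flatten S)].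

Inductive instr : Type :=
  | IConst of nat & Z
  | IAdd of nat & nat & nat
  | ISub of nat & nat & nat
  | ILoad of nat & nat
  | IStore of nat & nat
  | IJlt of nat & nat & nat
  | IJmp of nat
  | IHalt.

Definition program := seq instr.
Definition memory := nat -> Z.
Definition state := (nat * memory)%type.

Definition upd (M : memory) (i : nat) (z : Z) : memory :=
  fun a => if a == i then z else M a.

(* one step; None when the machine has halted
   (Halt instruction or program counter outside the program) *)
Definition step (P : program) (s : state) : option state :=
  let: (pc, M) := s in
  match nth IHalt P pc with
  | IConst i c => Some (pc.+1, upd M i c)
  | IAdd i j k => Some (pc.+1, upd M i (M j + M k)%Z)
  | ISub i j k => Some (pc.+1, upd M i (M j - M k)%Z)
  | ILoad i j => Some (pc.+1, upd M i (M (Z.to_nat (M j))))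
  | IStore i j => Some (pc.+1, upd M (Z.to_nat (M i)) (M j))
  | IJlt i j l => Some (if (M i <? M j)%Z then l else pc.+1, M)
  | IJmp l => Some (l, M)
  | IHalt => None
  end.

Fixpoint run (P : program) (t : nat) (s : state) : state :=
  match t with
  | 0 => s
  | t'.+1 => match step P s with None => s | Some s' => run P t' s' end
  end.

Definition halted (P : program) (s : state) : bool :=
  if step P s is None then true else false.

(* Input encoding: M[0] = n; for leaf i+1 (i < n-1), cells 1+4i .. 4+4i hold
   the number of labels of the edge followed by its (at most 3) labels,
   padded with 0; all other cells are 0. *)
Definition encode (S : seq (seq nat)) : memory :=
  fun a =>
    if a == 0 then Z.of_nat (star_nverts S)
    else
      let i := a.-1 %/ 4 in
      let j := a.-1 %% 4 in
      if i < size S then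
        let s := nth [::] S i in
        if j == 0 then Z.of_nat (size s) else Z.of_nat (nth 0 s j.-1)
      else 0%Z.

(* Main.v *)
Require Import Defs.
From Stdlib Require Import ZArith.
From mathcomp Require Import all_boot zify.

(* Pad the labels of each leaf with zeros and sort them as lo <= mid <= hi. A
   visit to the leaf may be assumed to be [lo, mid] or [mid, hi], so mid always
   lies in the visit interval and the leaves are visited in the order of their
   middle labels. Going through them in this order, the greedy choice of the
   visit that ends first is optimal. The padding makes leaves with fewer labels
   uniform: a visit starting at the label 0 is never possible, since the elapsed
   time is at least 0. On the machine the order is produced by a tournament
   tree, whose winner is raised to infinity and replayed up to the root. *)

Set Implicit Arguments.
Unset Strict Implicit.
Unset Printing Implicit Defensive.

(** * A structured language and its compilation to machine code *)

Inductive cmd : Type :=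
  | Const of nat & Z
  | Plus of nat & nat & nat
  | Minus of nat & nat & nat
  | Fetch of nat & nat
  | Store of nat & nat
  | Seq of cmd & cmd
  | If of nat & nat & cmd & cmd
  | While of nat & nat & cmd.

Notation "c1 ;; c2" := (Seq c1 c2) (at level 61, right associativity).

(** The state is split into registers [g] and heap [h]. The side conditions of [Fetch] and [Store]
    keep heap addresses off the cells that implement registers, so the two never alias. The counter
    is the exact number of machine steps, jumps included. *)
Inductive sem : cmd -> memory -> memory -> nat -> memory -> memory -> Prop :=
  | SemConst i c g h : sem (Const i c) g h 1 (upd g i c) h
  | SemPlus i j k g h : sem (Plus i j k) g h 1 (upd g i (g j + g k)%Z) h
  | SemMinus i j k g h : sem (Minus i j k) g h 1 (upd g i (g j - g k)%Z) h
  | SemFetch i j g h : Z.to_nat (g j) %% 4 != 1 ->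
      sem (Fetch i j) g h 1 (upd g i (h (Z.to_nat (g j)))) h
  | SemStore i j g h : Z.to_nat (g i) %% 4 != 1 ->
      sem (Store i j) g h 1 g (upd h (Z.to_nat (g i)) (g j))
  | SemSeq c1 c2 g h t1 g1 h1 t2 g2 h2 :
      sem c1 g h t1 g1 h1 -> sem c2 g1 h1 t2 g2 h2 ->
      sem (c1 ;; c2) g h (t1 + t2) g2 h2
  | SemIfT i j c1 c2 g h t g' h' :
      (g i <? g j)%Z -> sem c1 g h t g' h' -> sem (If i j c1 c2) g h t.+1 g' h'
  | SemIfF i j c1 c2 g h t g' h' :
      (g i <? g j)%Z = false -> sem c2 g h t g' h' ->
      sem (If i j c1 c2) g h t.+2 g' h'
  | SemWhileF i j c g h : (g i <? g j)%Z = false ->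
      sem (While i j c) g h 2 g h
  | SemWhileT i j c g h t1 g1 h1 t2 g2 h2 :
      (g i <? g j)%Z -> sem c g h t1 g1 h1 ->
      sem (While i j c) g1 h1 t2 g2 h2 ->
      sem (While i j c) g h (t1 + t2).+2 g2 h2.

Fixpoint csize (c : cmd) : nat :=
  match c with
  | Seq c1 c2 => csize c1 + csize c2
  | If _ _ c1 c2 => (csize c2 + csize c1).+2
  | While _ _ c => (csize c).+3
  | _ => 1
  end.

(* The cell 4r+1 holds the number of labels of leaf r in the input; as labels
   are positive and padded with zeros this number is redundant, so exactly
   these cells serve as registers. *)
Definition reg (r : nat) : nat := (4 * r).+1.

Fixpoint compile (b : nat) (c : cmd) : program :=
  match c with
  | Const i z => [:: IConst (reg i) z]
  | Plus i j k => [:: IAdd (reg i) (reg j) (reg k)]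
  | Minus i j k => [:: ISub (reg i) (reg j) (reg k)]
  | Fetch i j => [:: ILoad (reg i) (reg j)]
  | Store i j => [:: IStore (reg i) (reg j)]
  | Seq c1 c2 => compile b c1 ++ compile (b + csize c1) c2
  | If i j c1 c2 =>
      IJlt (reg i) (reg j) (b + csize c2).+2 :: compile b.+1 c2 ++
      IJmp (b + (csize c2 + csize c1)).+2 :: compile (b + csize c2).+2 c1
  | While i j c =>
      [:: IJlt (reg i) (reg j) b.+2, IJmp (b + csize c).+3 &
          compile b.+2 c ++ [:: IJmp b]]
  end.

Lemma size_compile b c : size (compile b c) = csize c.
Proof.
elim: c b => //= [c1 IH1 c2 IH2|_ _ c1 IH1 c2 IH2|_ _ c IH] b.
- by rewrite size_cat IH1 IH2.
- by rewrite size_cat /= IH1 IH2 addnS.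
- by rewrite size_cat /= IH addn1.
Qed.

Definition code_at (P : program) (b : nat) (code : program) : Prop :=
  forall k, k < size code -> nth IHalt P (b + k) = nth IHalt code k.

Lemma code_at_cons P b i code :
  code_at P b (i :: code) -> nth IHalt P b = i /\ code_at P b.+1 code.
Proof.
move=> H; split; first by have := H 0 isT; rewrite addn0.
by move=> k lk; rewrite addSnnS (H k.+1).
Qed.

Lemma code_at_cat P b code1 code2 :
  code_at P b (code1 ++ code2) ->
  code_at P b code1 /\ code_at P (b + size code1) code2.
Proof.
move=> H; split=> k lk.
  by rewrite H ?size_cat ?nth_cat ?lk // ltn_addr.
rewrite -addnA H ?size_cat ?ltn_add2l // nth_cat ltnNge leq_addr /=.
by rewrite addKn.
Qed.

Definition represents (M : memory) (g h : memory) : Prop :=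
  (forall r, M (reg r) = g r) /\ (forall a, a %% 4 != 1 -> M a = h a).

Lemma reg_mod r : reg r %% 4 = 1. Proof. by rewrite /reg; lia. Qed.

Lemma represents_reg M g h i z :
  represents M g h -> represents (upd M (reg i) z) (upd g i z) h.
Proof.
case=> Hg Hh; split=> [r|a Ha]; rewrite /upd.
  have -> : (reg r == reg i) = (r == i) by rewrite /reg; lia.
  by rewrite Hg.
case: eqP => [E|_]; last exact: Hh.
by rewrite E reg_mod in Ha.
Qed.

Lemma represents_heap M g h a z : a %% 4 != 1 ->
  represents M g h -> represents (upd M a z) g (upd h a z).
Proof.
move=> Ha [Hg Hh]; split=> [r|b Hb]; rewrite /upd.
  case: eqP => [E|_]; last exact: Hg.
  by rewrite -E reg_mod in Ha.
by rewrite Hh.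
Qed.

(** Induction on the execution. Leaving [k] further steps open lets executions be chained: the steps
    of the second command serve as the [k] of the first. *)
Lemma compile_correct P c g h t g' h' : sem c g h t g' h' ->
  forall b M, code_at P b (compile b c) -> represents M g h ->
  exists2 M', represents M' g' h' &
    forall k, run P (t + k) (b, M) = run P k (b + csize c, M').
Proof.
elim=> {c g h t g' h'}.
- move=> i c g h b M /code_at_cons [E _] R.
  exists (upd M (reg i) c); first exact: represents_reg.
  by move=> k; rewrite /= E addn1.
- move=> i j l g h b M /code_at_cons [E _] R.
  exists (upd M (reg i) (g j + g l)%Z); first exact: represents_reg.
  by move=> k; rewrite /= E addn1 !R.1.
- move=> i j l g h b M /code_at_cons [E _] R.
  exists (upd M (reg i) (g j - g l)%Z); first exact: represents_reg.
  by move=> k; rewrite /= E addn1 !R.1.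
- move=> i j g h Ha b M /code_at_cons [E _] R.
  exists (upd M (reg i) (h (Z.to_nat (g j)))); first exact: represents_reg.
  by move=> k; rewrite /= E addn1 R.1 R.2.
- move=> i j g h Ha b M /code_at_cons [E _] R.
  exists (upd M (Z.to_nat (g i)) (g j)); first exact: represents_heap.
  by move=> k; rewrite /= E addn1 !R.1.
- move=> c1 c2 g h t1 g1 h1 t2 g2 h2 _ IH1 _ IH2 b M /=.
  case/code_at_cat; rewrite size_compile => C1 C2 R.
  have [M1 R1 E1] := IH1 _ _ C1 R; have [M2 R2 E2] := IH2 _ _ C2 R1.
  by exists M2 => // k; rewrite -addnA E1 E2 addnA.
- move=> i j c1 c2 g h t g' h' lt _ IH b M /=.
  case/code_at_cons=> E /code_at_cat [_]; rewrite size_compile addSn.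
  case/code_at_cons=> _ C1 R; have [M' R' E'] := IH _ _ C1 R.
  by exists M' => // k; rewrite /= E !R.1 lt E' !addnS !addSn addnA.
- move=> i j c1 c2 g h t g' h' nlt _ IH b M /=.
  case/code_at_cons=> E /code_at_cat [C2]; rewrite size_compile addSn.
  case/code_at_cons=> EJ _ R; have [M' R' E'] := IH _ _ C2 R.
  exists M' => // k; rewrite /= E !R.1 nlt.
  have /= := E' k.+1; rewrite addnS /= addSn EJ => ->.
  by rewrite !addnS.
- move=> i j c g h nlt b M /= /code_at_cons [E /code_at_cons [EJ _]] R.
  by exists M => // k; rewrite /= E !R.1 nlt /= EJ !addnS.
move=> i j c g h t1 g1 h1 t2 g2 h2 lt _ IH1 _ IH2 b M CW R.
move: (CW) => /= /code_at_cons [E /code_at_cons [_ /code_at_cat []]].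
rewrite size_compile => C1 /code_at_cons [EJ _].
have [M1 R1 E1] := IH1 _ _ C1 R; have [M2 R2 E2] := IH2 _ _ CW R1.
exists M2 => // k; rewrite /= E !R.1 lt -addnA.
by have /= := E1 (t2 + k).+1; rewrite addnS /= addSn addSn EJ E2 => ->.
Qed.

(** * Total correctness with time bounds *)

Definition wp (c : cmd) (t : nat) (Q : memory -> memory -> Prop) (g h : memory) :=
  exists t' g' h', [/\ t' <= t, sem c g h t' g' h' & Q g' h'].

Lemma wp_weaken c t t' (Q Q' : memory -> memory -> Prop) g h :
  t <= t' -> (forall g' h', Q g' h' -> Q' g' h') -> wp c t Q g h ->
  wp c t' Q' g h.
Proof.
move=> le_t QQ' [u [g' [h' [le_u S q]]]]; exists u, g', h'; split=> //.
- exact: leq_trans le_t.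
- exact: QQ'.
Qed.

Lemma wp_seq c1 c2 t1 t2 Q g h :
  wp c1 t1 (wp c2 t2 Q) g h -> wp (c1 ;; c2) (t1 + t2) Q g h.
Proof.
move=> [u1 [g1 [h1 [l1 S1 [u2 [g2 [h2 [l2 S2 q]]]]]]]].
by exists (u1 + u2), g2, h2; split=> //; [lia | apply: SemSeq S1 S2].
Qed.

Lemma wp_const i c Q g h : Q (upd g i c) h -> wp (Const i c) 1 Q g h.
Proof. by move=> q; exists 1, (upd g i c), h; split=> //; constructor. Qed.

Lemma wp_plus i j k Q g h :
  Q (upd g i (g j + g k)%Z) h -> wp (Plus i j k) 1 Q g h.
Proof.
by move=> q; exists 1, (upd g i (g j + g k)%Z), h; split=> //; constructor.
Qed.

Lemma wp_minus i j k Q g h :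
  Q (upd g i (g j - g k)%Z) h -> wp (Minus i j k) 1 Q g h.
Proof.
by move=> q; exists 1, (upd g i (g j - g k)%Z), h; split=> //; constructor.
Qed.

Lemma wp_plus_eq z i j k Q g h :
  (g j + g k = z)%Z -> Q (upd g i z) h -> wp (Plus i j k) 1 Q g h.
Proof. by move=> <-; apply: wp_plus. Qed.

Lemma wp_minus_eq z i j k Q g h :
  (g j - g k = z)%Z -> Q (upd g i z) h -> wp (Minus i j k) 1 Q g h.
Proof. by move=> <-; apply: wp_minus. Qed.

Lemma wp_fetch a i j Q g h : g j = Z.of_nat a -> a %% 4 != 1 ->
  Q (upd g i (h a)) h -> wp (Fetch i j) 1 Q g h.
Proof.
move=> E Ha q; exists 1, (upd g i (h a)), h; split=> //.
by rewrite -[a in h a]Nat2Z.id -E; apply: SemFetch; rewrite E Nat2Z.id.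
Qed.

Lemma wp_store a i j Q g h : g i = Z.of_nat a -> a %% 4 != 1 ->
  Q g (upd h a (g j)) -> wp (Store i j) 1 Q g h.
Proof.
move=> E Ha q; exists 1, g, (upd h a (g j)); split=> //.
by rewrite -[a in upd h a]Nat2Z.id -E; apply: SemStore; rewrite E Nat2Z.id.
Qed.

Lemma wp_if i j c1 c2 t Q g h :
  ((g i < g j)%Z -> wp c1 t Q g h) -> ((g j <= g i)%Z -> wp c2 t Q g h) ->
  wp (If i j c1 c2) t.+2 Q g h.
Proof.
move=> T F; case E: (g i <? g j)%Z.
  case/Z.ltb_lt/T: (E) => [u [g' [h' [l S q]]]].
  by exists u.+1, g', h'; split=> //; [lia | apply: SemIfT].
case/Z.ltb_ge/F: (E) => [u [g' [h' [l S q]]]].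
by exists u.+2, g', h'; split=> //; apply: SemIfF.
Qed.

(** The index of the invariant is a variant bounding the remaining iterations. Each costs two steps
    besides its body, for the test and the jump back, and so does leaving the loop. *)
Lemma wp_while (I : nat -> memory -> memory -> Prop) i j c t Q :
  (forall k g h, I k g h -> (g i < g j)%Z ->
     exists2 k', k' < k & wp c t (I k') g h) ->
  (forall k g h, I k g h -> (g j <= g i)%Z -> Q g h) ->
  forall k g h, I k g h -> wp (While i j c) (k * t.+2).+2 Q g h.
Proof.
move=> Istep Iend k; elim/ltn_ind: k => k IH g h Ik.
case E: (g i <? g j)%Z.
  have [k' lt_k [u1 [g1 [h1 [l1 S1 I1]]]]] :=
    Istep _ _ _ Ik (proj1 (Z.ltb_lt _ _) E).
  have [u2 [g2 [h2 [l2 S2 q]]]] := IH k' lt_k _ _ I1.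
  exists (u1 + u2).+2, g2, h2; split=> //; last exact: SemWhileT S1 S2.
  have : k'.+1 * t.+2 <= k * t.+2 by rewrite leq_mul2r lt_k orbT.
  by rewrite mulSn; lia.
exists 2, g, h; split=> //; first exact: SemWhileF.
by apply: (Iend _ _ _ Ik); apply/Z.ltb_ge.
Qed.

(** * Correctness of the greedy algorithm *)

Definition label (S : seq (seq nat)) (j k : nat) : nat :=
  nth 0 (nth [::] S j) k.

(** These nested minima and maxima are the outputs of a sorting network with three comparators, the
    one that [sort_leaf] executes. *)
Definition lo S j :=
  minn (minn (label S j 0) (label S j 1))
       (minn (maxn (label S j 0) (label S j 1)) (label S j 2)).
Definition mid S j :=
  maxn (minn (label S j 0) (label S j 1))
       (minn (maxn (label S j 0) (label S j 1)) (label S j 2)).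
Definition hi S j :=
  maxn (maxn (label S j 0) (label S j 1)) (label S j 2).

Lemma lo_le_mid S j : lo S j <= mid S j.
Proof. by rewrite /lo /mid; lia. Qed.

Lemma mid_le_hi S j : mid S j <= hi S j.
Proof. by rewrite /mid /hi; lia. Qed.

Lemma uniq_mem_flatten (T : eqType) (ss : seq (seq T)) s :
  uniq (flatten ss) -> s \in ss -> uniq s.
Proof.
elim: ss => //= s' ss IH; rewrite cat_uniq => /and3P [us' _ uss].
by rewrite inE => /predU1P [->|/IH ->].
Qed.

Section ValidInstance.

Variable S : seq (seq nat).
Hypothesis validS : valid_instance3 S.

Lemma edge_labelsP j : j < size S ->
  [/\ size (nth [::] S j) <= 3, all (fun l => 0 < l) (nth [::] S j) &
      uniq (nth [::] S j)].
Proof.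
move=> lt_j; case/and3P: validS => sz pos us.
have memS := mem_nth [::] lt_j; split; first exact: (allP sz).
  by apply/allP=> l ll; apply: (allP pos); apply/flattenP; exists (nth [::] S j).
exact: uniq_mem_flatten us memS.
Qed.

(** Only padding zeros can coincide; a positive minimum means that all three labels are genuine,
    hence distinct. *)
Lemma lo_lt_mid j : j < size S -> 0 < lo S j -> lo S j < mid S j.
Proof.
case/edge_labelsP; rewrite /lo /mid /label.
case: (nth _ _ _) => [|a [|b [|c [|d s]]]] //= _ _; rewrite ?inE; lia.
Qed.

Lemma mid_lt_hi j : j < size S -> 0 < mid S j -> mid S j < hi S j.
Proof.
case/edge_labelsP; rewrite /hi /mid /label.
case: (nth _ _ _) => [|a [|b [|c [|d s]]]] //= _ _; rewrite ?inE; lia.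
Qed.

Lemma mem_edge_labels j l : j < size S ->
  (l \in edge_labels S j.+1) =
  (0 < l) && [|| l == lo S j, l == mid S j | l == hi S j].
Proof.
case/edge_labelsP; rewrite /edge_labels /lo /hi /mid /label /=.
case: (nth _ _ _) => [|a [|b [|c [|d s]]]] //= _; rewrite ?inE ?in_nil; lia.
Qed.

Definition greedy_step (inf e j : nat) : nat :=
  if e < lo S j then mid S j else if e < mid S j then hi S j else inf.

Variable inf : nat.
Hypothesis hi_lt_inf : forall j, j < size S -> hi S j < inf.

(** Failure is absorbing: no label exceeds a time that is at least [inf], so every later step fails
    as well. *)
Lemma greedy_inf d e : all (fun j => j < size S) d -> inf <= e ->
  inf <= foldl (greedy_step inf) e d.
Proof.
elim: d e => //= j d IH e /andP [lt_j lt_d] le_e; apply: IH => //.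
rewrite /greedy_step; have := hi_lt_inf lt_j.
have := lo_le_mid S j; have := mid_le_hi S j; do 2?case: ifP; lia.
Qed.

Lemma journey_of_greedy d e : all (fun j => j < size S) d ->
  foldl (greedy_step inf) e d < inf ->
  exists2 J, journey_from S 0 0 e J & forall j, j \in d -> visits 0 J j.+1.
Proof.
elim: d e => [|j d IH] e /=; first by exists [::].
case/andP=> lt_j lt_d acc; have [J JJ vis] := IH _ lt_d acc.
have lt_inf : greedy_step inf e j < inf.
  by rewrite ltnNge; apply: contraL acc => ?; rewrite -leqNgt greedy_inf.
(* A step that does not fail is a round trip to the leaf. Its start exceeds [e], hence is positive,
   which excludes padding and makes the trip last a positive time. *)
suff [s [f [lt_es lt_sf fE sl fl]]] : exists s f, [/\ e < s, s < f,
    f = greedy_step inf e j, s \in edge_labels S j.+1 &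
    f \in edge_labels S j.+1].
  exists [:: (0, j.+1, s), (j.+1, 0, f) & J].
    by rewrite /= lt_j sl fl lt_es lt_sf fE JJ /= eqxx ?orbT.
  move=> i; rewrite inE => /predU1P [->|/vis].
    by rewrite /visits /= eqxx !orbT.
  by rewrite /visits /= => ->; rewrite !orbT.
have := lo_lt_mid lt_j; have := mid_lt_hi lt_j.
move: lt_inf; rewrite /greedy_step; do 2?case: ifP => ?.
- exists (lo S j), (mid S j); rewrite !mem_edge_labels // !eqxx !orbT.
  by split=> //; lia.
- exists (mid S j), (hi S j); rewrite !mem_edge_labels // !eqxx !orbT.
  by split=> //; lia.
- by rewrite ltnn.
Qed.

(* A trip (x, s, f) enters the leaf x at time s and leaves it at time f; the
   first condition makes the relation transitive. *)
Definition before (t u : nat * nat * nat) : bool :=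
  (t.1.2 < t.2) && (t.2 < u.1.2).

Definition is_trip (t : nat * nat * nat) : bool :=
  [&& t.1.2 < t.2, 0 < t.1.1, t.1.1 <= size S, t.1.2 \in edge_labels S t.1.1
    & t.2 \in edge_labels S t.1.1].

Lemma before_trans : transitive before.
Proof. by move=> u t v; rewrite /before; lia. Qed.

(** In a star a journey alternates between center and leaves, so a closed one splits into
    consecutive pairs of time edges, one pair per trip. The induction removes two time edges at
    once; a single one cannot lead from the center to itself. *)
Lemma trips_of_journey J p : journey_from S 0 0 p J ->
  exists2 ts, [/\ sorted before ts, all is_trip ts & all (fun t => p < t.1.2) ts] &
    forall x, 0 < x -> visits 0 J x -> x \in [seq t.1.1 | t <- ts].
Proof.
have [k] := ubnP (size J); elim: k J p => // k IH [|[[a x] s] [|[[y b] f] J]] p.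
- by move=> _ _; exists [::] => // x x0; rewrite /visits /=; lia.
- by move=> _ /and4P [te /eqP ea _ /eqP /= ex]; rewrite /= ea ex in te.
move=> sz /and4P [te1 /eqP ea lt_p /and4P [te2 /eqP ey lt_sf JJ]].
have {}sz : size J < k by move: sz => /=; lia.
move: te1 te2; rewrite ea ey /=.
case: x => [|x] /= in ey *; first by [].
rewrite orbF => /andP [lt_x sl].
case/andP=> /andP [/eqP eb _] fl; rewrite eb in JJ *.
have [ts [srt trs gt] mem] := IH J f sz JJ.
exists ((x.+1, s, f) :: ts).
  split=> /=.
  - rewrite path_min_sorted //; apply/allP=> t /(allP gt) /= lt_f.
    by rewrite /before /= lt_sf.
  - by rewrite trs /is_trip /= lt_sf sl fl lt_x.
  - rewrite lt_p /=; apply/allP=> t /(allP gt) /=; lia.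
move=> z z0; rewrite /visits /= inE (eq_sym 0) -[z == 0]negbK -lt0n z0 /=.
rewrite orbF orbA orbb eq_sym => /orP [->//|Jz].
by rewrite mem ?orbT // /visits Jz orbT.
Qed.

(** Of two distinct labels among three, the smaller is at most the middle one and the larger at
    least it. *)
Lemma trip_mid t : is_trip t -> t.1.2 <= mid S t.1.1.-1 <= t.2.
Proof.
case/and5P; case: t => [[[|x] s] f] //= lt_sf _ lt_x.
rewrite !mem_edge_labels //=.
have := lo_le_mid S x; have := mid_le_hi S x; lia.
Qed.

(** A trip starting at [lo] ends at [mid] or later, and one starting at [mid] ends at [hi]; in both
    cases the greedy choice is available and no later. *)
Lemma greedy_trip e t : is_trip t -> e < t.1.2 ->
  greedy_step inf e t.1.1.-1 <= t.2.
Proof.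
case/and5P; case: t => [[[|x] s] f] //= lt_sf _ lt_x.
rewrite !mem_edge_labels //= /greedy_step.
have := lo_le_mid S x; have := mid_le_hi S x; do 2?case: ifP; lia.
Qed.

(* The middle labels lie in the chosen visit intervals, so disjoint intervals
   are ordered as the middle labels are. *)
Lemma greedy_of_trips ts d e : sorted before ts -> all is_trip ts ->
  uniq d -> pairwise (fun i j => mid S i <= mid S j) d -> e < inf ->
  (forall j, j \in d -> exists2 t, t \in ts & t.1.1 = j.+1 /\ e < t.1.2) ->
  foldl (greedy_step inf) e d < inf.
Proof.
move=> srt trs; elim: d e => //= j d IH e /andP [njd ud] /andP [le_j pw] lt_e ex.
have [t tts [tj lt_t]] := ex j (mem_head _ _).
have trt := allP trs t tts; have := greedy_trip trt lt_t; rewrite tj /= => le_g.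
have lt_j : j < size S by case/and5P: trt; rewrite tj.
have le_hi : t.2 <= hi S j.
  case/and5P: trt; rewrite tj => _ _ _ _; rewrite mem_edge_labels //.
  have := lo_le_mid S j; have := mid_le_hi S j; lia.
apply: IH => //.
  exact: leq_ltn_trans (leq_trans le_g le_hi) (hi_lt_inf lt_j).
(* The trip [u] to a remaining leaf has to start after [t] ends, hence after the greedy time, which
   is at most [t.2]. *)
move=> i id; have [|u uts [ui lt_u]] := ex i; first by rewrite inE id orbT.
exists u => //; split=> //; apply: leq_ltn_trans le_g _.
have: before t u || before u t.
  have nequ : t != u.
    by apply: contraNneq njd => tu; move: ui; rewrite -tu tj => -[->].
  move: srt; rewrite (sorted_pairwise before_trans) => /(pairwiseP (0,0,0)) pts.
  have [lt_t' lt_u'] : index t ts < size ts /\ index u ts < size ts.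
    by rewrite !index_mem.
  have [nt nu] := (nth_index (0, 0, 0) tts, nth_index (0, 0, 0) uts).
  case: (ltngtP (index t ts) (index u ts)) => [lt|lt|eq].
  - by rewrite -[t in before t _]nt -[u in before _ u]nu pts.
  - by rewrite orbC -[t in before _ t]nt -[u in before u _]nu pts.
  - by case/eqP: nequ; rewrite -nt eq.
case/orP=> /andP [//] _ lt_ut.
have /andP [le_t _] := trip_mid trt.
have /andP [_ le_u] := trip_mid (allP trs u uts).
rewrite ui in le_u; rewrite tj in le_t.
have := leq_trans le_t (leq_trans (allP le_j i id) le_u).
by rewrite leqNgt lt_ut.
Qed.

Lemma greedy_explorable d : perm_eq d (iota 0 (size S)) ->
  pairwise (fun i j => mid S i <= mid S j) d -> 0 < inf ->
  (foldl (greedy_step inf) 0 d < inf) <-> explorable S.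
Proof.
move=> pd pw inf0; have memd j : (j \in d) = (j < size S).
  by rewrite (perm_mem pd) mem_iota.
split=> [acc|[J [JJ vis]]].
  have [|J JJ vis] := @journey_of_greedy d 0 _ acc.
    by apply/allP=> j; rewrite memd.
  exists J; split=> // -[|x]; first by rewrite /visits.
  by rewrite /star_nverts ltnS -memd => /vis.
have [ts [srt trs gt] mem] := trips_of_journey JJ.
apply: (greedy_of_trips srt trs) => //.
  by rewrite (perm_uniq pd) iota_uniq.
move=> j; rewrite memd => lt_j.
have /mapP [t tts ->] := mem j.+1 isT (vis j.+1 lt_j).
by exists t => //; split=> //; apply: (allP gt).
Qed.

End ValidInstance.

(** * Ancestors in the heap numbering of a binary tree, where halving gives the parent *)

Definition anc (i x : nat) : Prop := exists k, i = x %/ 2 ^ k.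

Lemma anc_refl x : anc x x.
Proof. by exists 0; rewrite divn1. Qed.

Lemma anc_half i x : anc i x -> anc (i %/ 2) x.
Proof. by case=> k ->; exists k.+1; rewrite expnSr divnMA. Qed.

Lemma anc_proper i x : anc i x -> i = x \/ anc i (x %/ 2).
Proof.
case=> -[|k] ->; first by left; rewrite divn1.
by right; exists k; rewrite expnS divnMA.
Qed.

Lemma anc_le i x : anc i x -> i <= x.
Proof. by case=> k ->; apply: leq_div. Qed.

Lemma anc_child i x : anc i x -> i != x -> anc (2 * i) x \/ anc (2 * i).+1 x.
Proof.
case=> -[|k] ->; first by rewrite divn1 eqxx.
move=> _; rewrite expnSr divnMA.
have : anc (x %/ 2 ^ k) x by exists k.
move: (x %/ 2 ^ k) => c ac.
have [E|E] : c = 2 * (c %/ 2) \/ c = (2 * (c %/ 2)).+1 by lia.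
  by left; rewrite -E.
by right; rewrite -E.
Qed.

Lemma anc_root x : 0 < x -> anc 1 x.
Proof.
elim/ltn_ind: x => x IH x0; have [->|x1] := eqVneq x 1; first exact: anc_refl.
have [||k E] := IH (x %/ 2); try lia.
by exists k.+1; rewrite expnS divnMA.
Qed.

(** Halving a number below [2 * m] gives one below [m], so no leaf is a proper ancestor of
    another. *)
Lemma anc_leaf m i j : i < m -> j < m -> anc (m + i) (m + j) -> i = j.
Proof. by move=> lt_i lt_j /anc_proper [|/anc_le]; lia. Qed.

Lemma wp_seq1 c1 c2 t Q g h :
  wp c1 1 (wp c2 t Q) g h -> wp (c1 ;; c2) t.+1 Q g h.
Proof. exact: wp_seq. Qed.

Notation Mov i j := (Plus i j 0).

(** [Mov 19 19] serves as a skip; [Mov] relies on register 0 containing 0. *)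
Definition cswap i j : cmd := If j i (Mov 19 i ;; Mov i j ;; Mov j 19) (Mov 19 19).

Lemma wp_cswap i j a b Q g h : 0 < i < 19 -> 0 < j < 19 -> i != j -> g 0 = 0%Z ->
  g i = Z.of_nat a -> g j = Z.of_nat b ->
  (forall g', g' i = Z.of_nat (minn a b) -> g' j = Z.of_nat (maxn a b) ->
     (forall r, r != i -> r != j -> r != 19 -> g' r = g r) -> Q g' h) ->
  wp (cswap i j) 5 Q g h.
Proof.
move=> ri rj nij g0 gi gj HQ.
have [e1 e2 e3 e4] : [/\ (i == 19) = false, (j == 19) = false, (0 == i) = false
  & (19 == i) = false] by split; lia.
apply: wp_if => lt.
  do 2![apply: wp_seq1; apply: wp_plus]; apply: wp_plus; apply: HQ; rewrite /upd.
  - by rewrite !eqxx (negPf nij) e2 /=; lia.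
  - by rewrite eqxx e3 e4 /=; lia.
  - by move=> r /negPf -> /negPf -> /negPf ->.
apply: (@wp_weaken _ 1 3 Q Q) => //; apply: wp_plus; apply: HQ; rewrite /upd.
- by rewrite e1; lia.
- by rewrite e2; lia.
- by move=> r _ _ /negPf ->.
Qed.

(** * The tournament tree on the machine *)

Section Machine.

Variable S : seq (seq nat).
Let m := size S.

(* Node i of the tournament tree stores at address node i the address of the
   middle label of a leaf, and just after it the address of its parent. The
   root is node 1, the children of i are 2i and 2i+1, and leaf j of the star is
   the leaf m + j of the tree. *)
Definition node (i : nat) : nat := 4 * (m + 1 + i) + 2.

(* Registers: 0, 1, 2 contain the constants 0, 1, 4; 3 the address of the unused
   node 0; 4 the end of the label area and 5 a pointer into it; 11 a pointer to
   a tree node; 12 a value playing the role of infinity; 13 the end of the last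
   visit of the greedy algorithm (infinity after a failure); 14 the address of
   the root; 15 the distance from the middle label of a leaf to its tree node;
   16 and above are scratch. *)
Definition consts (g : memory) : Prop :=
  [/\ g 0 = 0%Z, g 1 = 1%Z, g 2 = 4%Z & g 3 = Z.of_nat (node 0)] /\
  [/\ g 4 = Z.of_nat (4 * m + 2), g 14 = Z.of_nat (node 1)
    & g 15 = Z.of_nat (8 * m + 3)].

Definition tree (key : nat -> nat) (h : memory) (i : nat) : Prop :=
  exists2 j, j < m &
    [/\ h (node i) = Z.of_nat (4 * j + 3), anc i (m + j) &
        forall j', j' < m -> anc i (m + j') -> key j <= key j'].

Definition keys (key : nat -> nat) (h : memory) : Prop :=
  forall j, j < m -> h (4 * j + 3) = Z.of_nat (key j).

Definition parents (h : memory) (k : nat) : Prop :=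
  forall c, 2 * k <= c < 2 * m -> h (node c).+1 = Z.of_nat (node (c %/ 2)).

Definition outer_labels (h : memory) : Prop :=
  forall j, j < m ->
    h (4 * j + 2) = Z.of_nat (lo S j) /\ h (4 * j + 4) = Z.of_nat (hi S j).

(** The left child of node [i] has address [2 * node i - node 0], and the right child lies 4
    further. The machine cannot divide, so parents are reached through stored pointers; writing them
    here sets them all up during the construction of the tree. *)
Definition recompute : cmd :=
  Plus 16 11 11 ;; Minus 16 16 3 ;; Plus 17 16 2 ;;
  Fetch 18 16 ;; Fetch 19 17 ;; Fetch 20 18 ;; Fetch 21 19 ;;
  If 21 20 (Mov 18 19) (Mov 18 18) ;;
  Store 11 18 ;;
  Plus 16 16 1 ;; Store 16 11 ;; Plus 17 17 1 ;; Store 17 11.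

Ltac regs := unfold node in *; rewrite /upd /=; lia.

Definition recomputed key i (g h g' h' : memory) : Prop :=
  [/\ forall r, r < 16 -> g' r = g r, tree key h' i,
      forall a, a <= 4 * m -> h' a = h a,
      forall i', i' != i -> h' (node i') = h (node i') &
      forall c, h' (node c).+1 =
        if c %/ 2 == i then Z.of_nat (node i) else h (node c).+1].

Lemma wp_recompute key i g h : consts g -> g 11 = Z.of_nat (node i) ->
  0 < i < m -> keys key h -> tree key h (2 * i) -> tree key h (2 * i).+1 ->
  wp recompute 15 (recomputed key i g h) g h.
Proof.
case=> [[g0 g1 g2 g3] _] g11 lt_i kh [j1 lt_j1 [h1 a1 min1]] [j2 lt_j2 [h2 a2 min2]].
apply: wp_seq1; apply: wp_plus; apply: wp_seq1; apply: wp_minus.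
apply: wp_seq1; apply: wp_plus.
apply: wp_seq1; apply: (wp_fetch (a := node (2 * i))); [regs | regs |].
apply: wp_seq1; apply: (wp_fetch (a := node (2 * i).+1)); [regs | regs |].
rewrite h1 h2.
apply: wp_seq1; apply: (wp_fetch (a := 4 * j1 + 3)); [regs | regs |].
apply: wp_seq1; apply: (wp_fetch (a := 4 * j2 + 3)); [regs | regs |].
rewrite !kh //.
have anc2 j : j < m -> anc i (m + j) ->
    anc (2 * i) (m + j) \/ anc (2 * i).+1 (m + j).
  by move=> lt_j /anc_child; apply; lia.
(* The common tail of both branches, for the winner [j] left in register 18. *)
have fin g' j : j < m -> anc i (m + j) ->
    (forall j', j' < m -> anc i (m + j') -> key j <= key j') ->
    (forall r, r < 16 -> g' r = g r) -> g' 16 = Z.of_nat (node (2 * i)) ->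
    g' 17 = Z.of_nat (node (2 * i).+1) -> g' 18 = Z.of_nat (4 * j + 3) ->
    wp (Store 11 18 ;; Plus 16 16 1 ;; Store 16 11 ;;
        Plus 17 17 1 ;; Store 17 11) 5
      (recomputed key i g h) g' h.
  move=> lt_j aj minj G G16 G17 G18.
  have G1 : g' 1 = 1%Z by rewrite G.
  have G11 : g' 11 = Z.of_nat (node i) by rewrite G.
  apply: wp_seq1; apply: (wp_store (a := node i)); [regs | regs |].
  apply: wp_seq1; apply: wp_plus.
  apply: wp_seq1; apply: (wp_store (a := (node (2 * i)).+1)).
  - by regs.
  - by regs.
  apply: wp_seq1; apply: wp_plus.
  apply: (wp_store (a := (node (2 * i).+1).+1)).
  - by regs.
  - by regs.
  split.
  - move=> r lt_r; rewrite /upd.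
    have [-> ->] : (r == 17) = false /\ (r == 16) = false by lia.
    exact: G.
  - exists j => //; split=> //; rewrite /upd /node.
    by do 3?[case: eqP; first lia]; rewrite ?eqxx; lia.
  - by move=> a le_a; rewrite /upd /node; repeat case: eqP; lia.
  - by move=> i' ni; rewrite /upd /node; repeat case: eqP; lia.
  - by move=> c; rewrite /upd /= G11 /node; repeat case: eqP; lia.
have sub : (2 * i) %/ 2 = i /\ (2 * i).+1 %/ 2 = i by lia.
have ai1 : anc i (m + j1) by rewrite -sub.1; apply: anc_half.
have ai2 : anc i (m + j2) by rewrite -sub.2; apply: anc_half.
apply: (wp_seq (t1 := 3) (t2 := 5)); apply: wp_if; rewrite /upd /= => lt.
  apply: wp_plus; apply: (fin _ j2) => //; try by regs.
  - move=> j' lt_j' /anc2 [//|/(min1 _ lt_j')|/(min2 _ lt_j')]; lia.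
  - by move=> r; rewrite /upd; do 16?[case: r => //= r].
apply: wp_plus; apply: (fin _ j1) => //; try by regs.
- move=> j' lt_j' /anc2 [//|/(min1 _ lt_j')|/(min2 _ lt_j')]; lia.
- by move=> r; rewrite /upd; do 16?[case: r => //= r].
Qed.

(** Register 12 starts at 1 and accumulates the largest labels of all leaves, so in the end it
    exceeds every label and can act as infinity. *)
Definition sort_leaf : cmd :=
  Fetch 16 5 ;; Plus 20 5 1 ;; Fetch 17 20 ;; Plus 21 20 1 ;; Fetch 18 21 ;;
  cswap 16 17 ;; cswap 17 18 ;; cswap 16 17 ;;
  Store 5 16 ;; Store 20 17 ;; Store 21 18 ;;
  Plus 12 12 18 ;; Store 11 20 ;; Plus 11 11 2 ;; Plus 5 5 2.

Definition sorted_upto (inf j : nat) (h : memory) : Prop :=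
  forall i, i < j -> [/\ h (4 * i + 2) = Z.of_nat (lo S i),
    h (4 * i + 3) = Z.of_nat (mid S i), h (4 * i + 4) = Z.of_nat (hi S i),
    h (node (m + i)) = Z.of_nat (4 * i + 3) & hi S i < inf].

Definition sort_inv (k : nat) (g h : memory) : Prop := exists j inf,
  [/\ j + k = m, consts g, g 13 = 0%Z & sorted_upto inf j h] /\
  [/\ g 5 = Z.of_nat (4 * j + 2), g 11 = Z.of_nat (node (m + j)),
      g 12 = Z.of_nat inf, 0 < inf &
      forall i k, j <= i < m -> k < 3 ->
        h (4 * i + 2 + k) = Z.of_nat (label S i k)].

Lemma wp_sort g h : sort_inv m g h ->
  wp (While 5 4 sort_leaf) (m * 29).+2 (sort_inv 0) g h.
Proof.
apply: wp_while => {g h} k g h [j [inf [[Ejk C g13 SU] [g5 g11 g12 inf0 raw]]]].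
  move=> lt54; case: (C) => [[g0 g1 g2 g3] [g4 g14 g15]].
  case: k Ejk => [|k] Ejk; first lia.
  exists k => //.
  have lt_j : j < m by lia.
  apply: wp_seq1; apply: (wp_fetch (a := 4 * j + 2 + 0)); [regs | regs |].
  apply: wp_seq1; apply: wp_plus.
  apply: wp_seq1; apply: (wp_fetch (a := 4 * j + 2 + 1)); [regs | regs |].
  apply: wp_seq1; apply: wp_plus.
  apply: wp_seq1; apply: (wp_fetch (a := 4 * j + 2 + 2)); [regs | regs |].
  rewrite !raw //; try lia.
  set a := label S j 0; set b := label S j 1; set c := label S j 2.
  apply: (wp_seq (t1 := 5) (t2 := 17)).
  apply: (wp_cswap (a := a) (b := b)) => // ga a16 a17 Ga.
  apply: (wp_seq (t1 := 5) (t2 := 12)).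
  have a0 : ga 0 = 0%Z by rewrite Ga.
  have a18 : ga 18 = Z.of_nat c by rewrite Ga.
  apply: (wp_cswap (a := maxn a b) (b := c)) => //.
  move=> gb b17 b18 Gb.
  apply: (wp_seq (t1 := 5) (t2 := 7)).
  have b0 : gb 0 = 0%Z by rewrite Gb // Ga.
  have b16 : gb 16 = Z.of_nat (minn a b) by rewrite Gb.
  apply: (wp_cswap (a := minn a b) (b := minn (maxn a b) c)) => //.
  move=> gc c16 c17 Gc.
  have Gr r : r < 16 -> gc r = g r.
    move=> lt_r; rewrite Gc ?Gb ?Ga; try lia.
    by rewrite /upd; do 16?[case: r lt_r => //= r lt_r].
  have c18 : gc 18 = Z.of_nat (hi S j) by rewrite Gc.
  have c20 : gc 20 = Z.of_nat (4 * j + 3) by rewrite Gc // Gb // Ga //; regs.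
  have c21 : gc 21 = Z.of_nat (4 * j + 4) by rewrite Gc // Gb // Ga //; regs.
  have {}c16 : gc 16 = Z.of_nat (lo S j) by [].
  have {}c17 : gc 17 = Z.of_nat (mid S j) by [].
  have [G5 G11 G12 G2] : [/\ gc 5 = g 5, gc 11 = g 11, gc 12 = g 12 & gc 2 = g 2].
    by rewrite !Gr.
  apply: wp_seq1; apply: (wp_store (a := 4 * j + 2)); [regs | regs |].
  apply: wp_seq1; apply: (wp_store (a := 4 * j + 3)); [regs | regs |].
  apply: wp_seq1; apply: (wp_store (a := 4 * j + 4)); [regs | regs |].
  apply: wp_seq1; apply: wp_plus.
  apply: wp_seq1; apply: (wp_store (a := node (m + j))); [regs | regs |].
  apply: wp_seq1; apply: wp_plus; apply: wp_plus.
  exists j.+1, (inf + hi S j); split; split.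
  - lia.
  - by split; split; rewrite /upd /= Gr.
  - by rewrite /upd /= Gr.
  - move=> i; rewrite ltnS leq_eqVlt => /predU1P [->|lt_i].
      by split; rewrite /upd /node /=; repeat case: eqP; lia.
    have [e1 e2 e3 e4 e5] := SU i lt_i; unfold node in *.
    by split; rewrite /upd /=; repeat case: eqP; lia.
  - by regs.
  - by regs.
  - by regs.
  - lia.
  - move=> i l lt_i lt_l; have := raw i l; rewrite /upd /node /=.
    by repeat case: eqP; lia.
case: (C) => _ [g4 _ _]; rewrite g4 g5 => le45; exists j, inf; split; split=> //; lia.
Qed.

Lemma tree_frame key (h h' : memory) i :
  h' (node i) = h (node i) -> tree key h i -> tree key h' i.
Proof. by move=> E [j lt_j [hj aj minj]]; exists j => //; rewrite E. Qed.

Lemma keys_frame key (h h' : memory) :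
  (forall a, a <= 4 * m -> h' a = h a) -> keys key h -> keys key h'.
Proof. by move=> F kh j lt_j; rewrite F ?kh //; lia. Qed.

Lemma outer_labels_frame (h h' : memory) :
  (forall a, a <= 4 * m -> h' a = h a) -> outer_labels h -> outer_labels h'.
Proof. by move=> F oh j lt_j; rewrite !F; [apply: oh | lia | lia]. Qed.

Lemma consts_frame (g g' : memory) :
  (forall r, r < 16 -> r != 11 -> g' r = g r) -> consts g -> consts g'.
Proof. by move=> F; rewrite /consts !F. Qed.

(** Nodes are treated in decreasing order, and register 11 points to the one just below [k]. It is
    described by subtracting 4 from [node k] because [k] is 0 for a star without leaves. *)
Definition build_inv key inf (k : nat) (g h : memory) : Prop :=
  [/\ consts g, g 13 = 0%Z, g 12 = Z.of_nat inf,
      g 11 = (Z.of_nat (node k) - 4)%Z & k <= m] /\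
  [/\ keys key h, outer_labels h, parents h k &
      forall i, k <= i < 2 * m -> 0 < i -> tree key h i].

Lemma wp_build key inf g h : build_inv key inf m g h ->
  wp (While 3 11 (recompute ;; Minus 11 11 2)) (m * 18).+2
    (fun g' h' => exists2 k, k <= 1 & build_inv key inf k g' h') g h.
Proof.
apply: wp_while => {g h} k g h [[C g13 g12 g11 le_k] [kh oh ph th]].
  case: (C) => [[g0 g1 g2 g3] _] lt; have k2 : 1 < k by unfold node in *; lia.
  exists k.-1; first lia.
  apply: (wp_seq (t1 := 15) (t2 := 1)).
  apply: wp_weaken (leqnn 15) _
    (wp_recompute (key := key) (i := k.-1) C _ _ kh _ _).
  - move=> g' h' [G ti hl hn hp]; apply: wp_minus; split; split.
    + by apply: consts_frame C => r lt_r nr; rewrite /upd (negPf nr) G.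
    + by rewrite /upd /= G.
    + by rewrite /upd /= G.
    + rewrite /upd /= !G // g11 g2 /node; lia.
    + lia.
    + exact: keys_frame kh.
    + exact: outer_labels_frame oh.
    + move=> c lt_c; rewrite hp; case: eqP => [-> //|nc]; apply: ph; lia.
    + move=> i lt_i i0; have [-> //|ni] := eqVneq i k.-1.
      apply: tree_frame (hn i ni) _; apply: th => //; lia.
  - by rewrite g11 /node; lia.
  - lia.
  - by apply: th; lia.
  - by apply: th; lia.
case: (C) => [[_ _ _ g3] _]; rewrite g3 g11 /node => le; exists k; first lia.
by split.
Qed.

Definition climb : cmd :=
  While 14 11 (Plus 16 11 1 ;; Fetch 11 16 ;; recompute).

(** Only proper ancestors of the current node [c] may hold an outdated winner. As [c] is below
    [2 ^ k.+1], at most [k] halvings lead to the root. *)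
Definition climb_inv key j0 (g0 h0 : memory) (k : nat) (g h : memory) : Prop :=
  exists c, [/\ 0 < c < 2 * m, c < 2 ^ k.+1, anc c (m + j0) &
               g 11 = Z.of_nat (node c)] /\
  [/\ forall r, r < 16 -> r != 11 -> g r = g0 r,
      forall a, a <= 4 * m -> h a = h0 a, parents h 1 &
      forall i, 0 < i < 2 * m -> (anc i c -> i = c) -> tree key h i].

Lemma wp_climb key j0 g0 h0 k g h : consts g0 -> keys key h0 ->
  climb_inv key j0 g0 h0 k g h ->
  wp climb (k * 19).+2
    (fun g' h' => [/\ forall r, r < 16 -> r != 11 -> g' r = g0 r,
      forall a, a <= 4 * m -> h' a = h0 a, parents h' 1 &
      forall i, 0 < i < 2 * m -> tree key h' i]) g h.
Proof.
move=> C0 kh0; apply: wp_while => {k g h} k g h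
  [c [[lt_c lt_ck ac g11] [G H ph th]]].
  have C := consts_frame G C0; case: (C) => [[_ g1 _ _] [_ g14 _]].
  rewrite g14 g11 /node => lt; have c1 : 1 < c by lia.
  case: k lt_ck => [|k] lt_ck; first by move: lt_ck; rewrite expn1; lia.
  exists k => //.
  apply: wp_seq1; apply: wp_plus.
  apply: wp_seq1; apply: (wp_fetch (a := (node c).+1)); [regs | regs |].
  rewrite ph; last lia.
  apply: wp_weaken (leqnn 15) _
    (wp_recompute (key := key) (i := c %/ 2) _ _ _ _ _ _).
  - move=> g' h' [G' ti hl hn hp]; exists (c %/ 2); split; split.
    + lia.
    + by move: lt_ck; rewrite (expnS 2 k.+1); lia.
    + exact: anc_half.
    + by rewrite G'.
    + move=> r lt_r nr; rewrite G' // /upd (negPf nr).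
      have -> : (r == 16) = false by lia. exact: G.
    + by move=> a le_a; rewrite hl ?H.
    + move=> d lt_d; rewrite hp; case: eqP => [-> //|nd]; apply: ph; lia.
    + move=> i lt_i ai; have [-> //|ni] := eqVneq i (c %/ 2).
      apply: tree_frame (hn i ni) _; apply: th => // /anc_proper [//|/ai] E.
      by rewrite E eqxx in ni.
  - by apply: consts_frame C => r lt_r /negPf nr; rewrite /upd nr;
      have -> : (r == 16) = false by lia.
  - by rewrite /upd.
  - lia.
  - exact: keys_frame kh0.
  - by apply: th; [lia | move=> /anc_proper [//|/anc_le]; lia].
  - by apply: th; [lia | move=> /anc_proper [//|/anc_le]; lia].
have C := consts_frame G C0; case: (C) => [_ [_ g14 _]].
rewrite g14 g11 /node => le; have c1 : c = 1 by lia.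
by split=> // i lt_i; apply: th => //; rewrite c1 => /anc_le; lia.
Qed.

(** The cells around the middle label of the winner contain its [lo] and [hi], and the nested tests
    carry out [greedy_step]. Register 5 now only counts the rounds, in the address units of the
    label area. *)
Definition pop : cmd :=
  Fetch 6 14 ;; Minus 16 6 1 ;; Fetch 16 16 ;; Fetch 17 6 ;;
  Plus 18 6 1 ;; Fetch 18 18 ;;
  If 13 16 (Mov 13 17) (If 13 17 (Mov 13 18) (Mov 13 12)) ;;
  Store 6 12 ;; Plus 11 6 15 ;; climb ;; Plus 5 5 2.

Definition live_key inf (d : seq nat) (j : nat) : nat :=
  if j \in d then inf else mid S j.

Definition pop_inv inf (k : nat) (g h : memory) : Prop := exists d : seq nat,
  [/\ size d + k = m, uniq d, all (fun j => j < m) d,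
      pairwise (fun i j => mid S i <= mid S j) d &
      forall a b, a \in d -> b < m -> b \notin d -> mid S a <= mid S b] /\
  [/\ consts g, g 5 = Z.of_nat (4 * size d + 2),
      g 13 = Z.of_nat (foldl (greedy_step S inf) 0 d) & g 12 = Z.of_nat inf] /\
  [/\ keys (live_key inf d) h, outer_labels h, parents h 1 &
      forall i, 0 < i < 2 * m -> tree (live_key inf d) h i].

Lemma exists_notin (d : seq nat) : size d < m ->
  exists2 b, b < m & b \notin d.
Proof.
move=> lt_d; have [/allP sub|/allPn [b]] := boolP (all (mem d) (iota 0 m)).
  by have := uniq_leq_size (iota_uniq 0 m) sub; rewrite size_iota leqNgt lt_d.
by rewrite mem_iota => /= lt_b nb; exists b.
Qed.

(* Raising the key of leaf j only invalidates the nodes properly above it. *)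
Lemma tree_raise inf d j h i : j < m -> j \notin d -> mid S j < inf ->
  (anc i (m + j) -> i = m + j) -> 0 < i < 2 * m ->
  tree (live_key inf d) h i ->
  tree (live_key inf (rcons d j)) (upd h (4 * j + 3) (Z.of_nat inf)) i.
Proof.
move=> lt_j nj lt_inf ai lt_i [j1 lt_j1 [hj1 aj1 minj1]]; exists j1 => //.
split=> //; first by rewrite /upd /node; case: eqP; [lia | rewrite -hj1].
move=> j' lt_j'; have [E|n1] := eqVneq j1 j.
  by rewrite E in aj1 *; rewrite (ai aj1) => /(anc_leaf lt_j lt_j') ->.
move=> /(minj1 _ lt_j'); rewrite /live_key !mem_rcons !inE (negPf n1) /=.
by have [->|//] := eqVneq j' j; rewrite (negPf nj) /=; case: ifP; lia.
Qed.

Lemma wp_pop inf K g h : (forall j, j < m -> hi S j < inf) -> 2 * m <= 2 ^ K.+1 ->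
  pop_inv inf m g h ->
  wp (While 5 4 pop) (m * (K * 19 + 16).+2).+2 (pop_inv inf 0) g h.
Proof.
move=> hi_inf leK; apply: wp_while => {g h} k g h
  [d [[Ek ud ltd pwd le_d] [[C g5 g13 g12] [kh oh ph th]]]]; last first.
  case: (C) => [_ [g4 _ _]]; rewrite g4 g5 => le; exists d; split=> //.
  by split=> //; lia.
case: (C) => [[g0 g1 g2 g3] [g4 g14 g15]] lt54.
have lt_d : size d < m by lia.
exists k.-1; first lia.
have [b lt_b nb] := exists_notin lt_d.
have [j lt_j [hj aj minj]] : tree (live_key inf d) h 1 by apply: th; lia.
have {}minj i : i < m -> live_key inf d j <= live_key inf d i.
  by move=> lt_i; apply: minj => //; apply: anc_root; lia.
have mid_inf i : i < m -> mid S i < inf.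
  by move=> lt_i; apply: leq_ltn_trans (mid_le_hi S i) (hi_inf i lt_i).
(* The unvisited leaf [b] has a key below [inf], so a leaf of minimal key cannot be one that was
   already raised. *)
have nj : j \notin d.
  have := minj b lt_b; rewrite /live_key (negPf nb); case: ifP => // _.
  by have := mid_inf b lt_b; lia.
have khj : h (4 * j + 3) = Z.of_nat (mid S j).
  by rewrite kh // /live_key (negPf nj).
have [hlo hhi] := oh j lt_j.
rewrite addnC.
apply: wp_seq1; apply: (wp_fetch (a := node 1)); [regs | regs | rewrite hj].
apply: wp_seq1; apply: wp_minus.
apply: wp_seq1; apply: (wp_fetch (a := 4 * j + 2)); [regs | regs | rewrite hlo].
apply: wp_seq1; apply: (wp_fetch (a := 4 * j + 3)); [regs | regs | rewrite khj].
apply: wp_seq1; apply: wp_plus.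
apply: wp_seq1; apply: (wp_fetch (a := 4 * j + 4)); [regs | regs | rewrite hhi].
set ga := upd _ 18 _; set e := foldl _ _ _ in g13.
have Ga r : r < 16 -> r != 6 -> ga r = g r.
  by rewrite /ga /upd => lt_r /negPf ->; do 16?[case: r lt_r => //= r lt_r].
have [a0 a16 a17 a18] : [/\ ga 0 = 0%Z, ga 16 = Z.of_nat (lo S j),
  ga 17 = Z.of_nat (mid S j) & ga 18 = Z.of_nat (hi S j)].
  by rewrite Ga.
have a6 : ga 6 = Z.of_nat (4 * j + 3) by [].
have [a13 a12] : ga 13 = Z.of_nat e /\ ga 12 = Z.of_nat inf by rewrite !Ga.
(* Five steps for the nested tests; the rest pays for raising the key, locating the tree leaf,
   climbing and counting. *)
rewrite -[X in wp _ X](_ : 5 + (K * 19 + 5) = _); last by lia.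
move: ga Ga a0 a16 a17 a18 a6 a13 a12 => ga Ga a0 a16 a17 a18 a6 a13 a12.
apply: wp_seq.
apply: (@wp_weaken _ 5 5 (fun g' h' =>
  [/\ h' = h, g' 13 = Z.of_nat (greedy_step S inf e j) &
      forall r, r != 13 -> g' r = ga r])) => //; last first.
  apply: wp_if => lt1; [|apply: wp_if => lt2].
  - apply: (@wp_weaken _ 1) (fun _ _ q => q) _ => //; apply: wp_plus.
    split=> // [|r /negPf nr]; rewrite /upd ?nr //= /greedy_step.
    by case: ifP; lia.
  - apply: wp_plus; split=> // [|r /negPf nr]; rewrite /upd ?nr //= /greedy_step.
    by do 2?case: ifP; lia.
  - apply: wp_plus; split=> // [|r /negPf nr]; rewrite /upd ?nr //= /greedy_step.
    by do 2?case: ifP; lia.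
move=> gb _ [-> b13 Gb].
have b6 : gb 6 = Z.of_nat (4 * j + 3) by rewrite Gb.
have b12 : gb 12 = Z.of_nat inf by rewrite Gb.
have b15 : gb 15 = Z.of_nat (8 * m + 3) by rewrite Gb // Ga.
rewrite addnS; apply: wp_seq1; apply: (wp_store (a := 4 * j + 3)); [regs | regs |].
rewrite addnS; apply: wp_seq1; apply: wp_plus; rewrite b12.
rewrite -[X in wp _ X](_ : (K * 19).+2 + 1 = _); last by lia.
set gc := upd gb 11 _; set hc := upd h _ _.
have Gc r : r < 16 -> r != 6 -> r != 11 -> r != 13 -> gc r = g r.
  by move=> lt_r n6 n11 n13; rewrite /gc /upd (negPf n11) Gb // Ga.
have khc : keys (live_key inf (rcons d j)) hc.
  move=> i lt_i; rewrite /hc /upd /live_key mem_rcons inE.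
  have -> : (4 * i + 3 == 4 * j + 3) = (i == j) by lia.
  by case: eqP => //= _; apply: kh.
apply: wp_seq.
apply: wp_weaken (leqnn _) _
  (@wp_climb (live_key inf (rcons d j)) j gc hc K gc hc _ _ _).
- move=> g' h' [G' H' ph' th']; apply: wp_plus; exists (rcons d j); split; split.
  + by rewrite size_rcons; lia.
  + by rewrite rcons_uniq nj.
  + by rewrite all_rcons lt_j.
  + rewrite -cats1 pairwise_cat pwd /= andbT; apply/allrelP=> a i ad.
    by rewrite inE => /eqP ->; apply: le_d.
  + move=> a i; rewrite !mem_rcons !inE negb_or.
    move=> /predU1P [->|ad] lt_i /andP [_ ni].
      by have := minj i lt_i; rewrite /live_key (negPf nj) (negPf ni).
    exact: le_d.
  + split.
    * split; split; rewrite /upd /= G' // Gc //.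
    * by rewrite /upd /= size_rcons !G' // !Gc // g5 g2; lia.
    * by rewrite /upd /= G' // foldl_rcons.
    * by rewrite /upd /= G' // Gc.
  + split=> //.
    * exact: keys_frame H' khc.
    * apply: outer_labels_frame H' _ => i lt_i; have := oh i lt_i.
      by rewrite /hc /upd; repeat case: eqP; lia.
- by split; split; rewrite Gc.
- exact: khc.
exists (m + j); split; split => //.
- lia.
- lia.
- exact: anc_refl.
- by rewrite /gc /upd /= b6 b15 /node; lia.
- move=> c lt_c; rewrite /hc /upd /node; case: eqP; first lia.
  by move=> _; apply: ph.
- by move=> i lt_i ai; apply: tree_raise => //; [apply: mid_inf | apply: th].
Qed.

End Machine.

(** * The whole program and its running time *)

Definition init : cmd :=
  Const 0 0 ;; Const 1 1 ;; Const 2 4 ;; Fetch 3 0 ;;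
  Plus 3 3 3 ;; Plus 3 3 3 ;; Minus 4 3 1 ;; Minus 4 4 1 ;;
  Plus 3 3 1 ;; Plus 3 3 1 ;; Const 12 1 ;; Const 13 0 ;;
  Plus 14 3 2 ;; Plus 15 4 4 ;; Minus 15 15 1 ;; Const 5 2 ;;
  Const 16 3 ;; Plus 11 15 16.

(** [Minus 11 15 1] yields [8 * m + 2], which is [node m - 4]: the construction starts at the last
    inner node. *)
Definition star_exp3 : cmd :=
  init ;; While 5 4 sort_leaf ;; Minus 11 15 1 ;;
  While 3 11 (recompute ;; Minus 11 11 2) ;; Const 5 2 ;;
  While 5 4 pop ;; If 13 12 (Store 0 1) (Store 0 0).

Lemma encode_label S i k : i < size S -> k < 3 ->
  encode S (4 * i + 2 + k) = Z.of_nat (label S i k).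
Proof.
move=> lt_i lt_k; rewrite /encode.
have -> : (4 * i + 2 + k == 0) = false by lia.
have [-> ->] : (4 * i + 2 + k).-1 %/ 4 = i /\
  (4 * i + 2 + k).-1 %% 4 = k.+1 by lia.
by rewrite lt_i.
Qed.

Lemma wp_init S g : wp init 18 (sort_inv S (size S)) g (encode S).
Proof.
set n := Z.of_nat (size S).+1.
do 3![apply: wp_seq1; apply: wp_const].
apply: wp_seq1; apply: (wp_fetch (a := 0)) => //.
have -> : encode S 0 = n by [].
apply: wp_seq1; apply: (wp_plus_eq (z := (2 * n)%Z));
  first by rewrite /upd /=; lia.
apply: wp_seq1; apply: (wp_plus_eq (z := (4 * n)%Z));
  first by rewrite /upd /=; lia.
apply: wp_seq1; apply: (wp_minus_eq (z := (4 * n - 1)%Z));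
  first by rewrite /upd /=; lia.
apply: wp_seq1; apply: (wp_minus_eq (z := (4 * n - 2)%Z));
  first by rewrite /upd /=; lia.
apply: wp_seq1; apply: (wp_plus_eq (z := (4 * n + 1)%Z));
  first by rewrite /upd /=; lia.
apply: wp_seq1; apply: (wp_plus_eq (z := (4 * n + 2)%Z));
  first by rewrite /upd /=; lia.
do 2![apply: wp_seq1; apply: wp_const].
apply: wp_seq1; apply: (wp_plus_eq (z := (4 * n + 6)%Z));
  first by rewrite /upd /=; lia.
apply: wp_seq1; apply: (wp_plus_eq (z := (8 * n - 4)%Z));
  first by rewrite /upd /=; lia.
apply: wp_seq1; apply: (wp_minus_eq (z := (8 * n - 5)%Z));
  first by rewrite /upd /=; lia.
do 2![apply: wp_seq1; apply: wp_const].
apply: (wp_plus_eq (z := (8 * n - 2)%Z));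
  first by rewrite /upd /=; lia.
rewrite {}/n.
exists 0, 1; rewrite /consts /node /upd /=.
split; split; rewrite ?add0n //; try lia.
- by split; split; lia.
- by move=> i k lt_i lt_k; apply: encode_label.
Qed.

Lemma wp_star_exp3 S L g : valid_instance3 S -> size S < 2 ^ L.+1 ->
  wp star_exp3 (100 * ((size S).+1 * L.+1))
    (fun _ h => h 0 = 1%Z <-> explorable S) g (encode S).
Proof.
move=> vS ltL; set m := size S.
set t3 := (m * ((L.+1) * 19 + 16).+2).+2.
pose t := 18 + ((m * 29).+2 + (1 + ((m * 18).+2 + (1 + (t3 + 3))))).
apply: (@wp_weaken _ t _ (fun _ h => h 0 = 1%Z <-> explorable S)) => //.
  (* With [m] leaves the total is [29 + 65 * m + 19 * m * L.+1]. *)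
  by rewrite /t /t3; nia.
apply: wp_seq; apply: wp_weaken (leqnn _) _ (wp_init S g) => {g} g h sI.
apply: wp_seq; apply: wp_weaken (leqnn _) _ (wp_sort sI) => {g h sI} g h.
case=> j [inf [[Ej C g13 SU] [_ _ g12 inf0 _]]].
move: Ej; rewrite addn0 => Ej; rewrite {j}Ej in SU.
have hi_inf j : j < size S -> hi S j < inf by case/SU.
case: (C) => [[g0 g1 g2 g3] [g4 g14 g15]].
apply: wp_seq; apply: wp_minus; rewrite g15 g1.
apply: wp_seq.
apply: wp_weaken (leqnn _) _ (@wp_build S (mid S) inf _ _ _); last first.
  split; split.
  - by apply: consts_frame C => r _ /negPf nr; rewrite /upd nr.
  - by [].
  - by [].
  - by rewrite /upd /= /node; lia.
  - by [].
  - by move=> j /SU [].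
  - by move=> j /SU [].
  - by move=> c; lia.
  - move=> i lt_i _; have Ei : i = size S + (i - size S) by lia.
    have lt_j : i - size S < size S by lia.
    exists (i - size S) => //; rewrite -Ei.
    split; first by have [_ _ _ + _] := SU _ lt_j; rewrite -Ei.
      exact: anc_refl.
    by move=> j lt; rewrite {1}Ei => /(anc_leaf lt_j lt) ->.
move=> {g h C SU g13 g12 g0 g1 g2 g3 g4 g14 g15} g h [k k1].
case=> [[C g13 g12 _ _] [kh oh ph th]].
apply: wp_seq; apply: wp_const.
apply: wp_seq.
apply: wp_weaken (leqnn _) _ (@wp_pop S inf L.+1 _ _ hi_inf _ _); last first.
- exists [::]; split; split=> //.
  + split=> //; first by move=> c lt_c; apply: ph; lia.
    by move=> i lt_i; apply: th; lia.
- by move: ltL; rewrite (expnS 2 L.+1); lia.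
move=> {g h C g13 g12 kh oh ph th} g h.
case=> d [[sd ud ltd pd _] [[C _ g13 g12] _]].
(* After [m] rounds [d] has [m] distinct entries below [m], so every leaf has been treated. *)
have pi : perm_eq d (iota 0 (size S)).
  rewrite uniq_perm ?iota_uniq // => j; rewrite mem_iota /= add0n.
  have sub : {subset d <= iota 0 (size S)}.
    by move=> i /(allP ltd); rewrite mem_iota.
  have [|_ ->] := uniq_min_size ud sub; last by rewrite mem_iota.
  by rewrite size_iota -[X in X <= _]sd addn0.
have [accepts complete] := greedy_explorable vS hi_inf pi pd inf0.
case: (C) => [[g0 g1 _ _] _].
apply: wp_if => lt; apply: (wp_store (a := 0)) => //; rewrite /upd /= ?g0 ?g1.
  by split=> // _; apply: accepts; lia.
by split=> // /complete; lia.
Qed.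

Lemma ltn_exp_log2 n : 0 < n -> n < 2 ^ (Nat.log2 n).+1.
Proof.
have E k : Nat.pow 2 k = 2 ^ k by elim: k => //= k ->; rewrite expnS; lia.
by move=> /ltP/Nat.log2_spec [_ /ltP]; rewrite E.
Qed.

Lemma run_end P M k : run P k (size P, M) = (size P, M).
Proof. by case: k => //= k; rewrite nth_default. Qed.

Lemma halted_end P M : halted P (size P, M).
Proof. by rewrite /halted /= nth_default. Qed.

(* There is a RAM program P and a constant C such that on every temporal star
   on n vertices with at most 3 labels per edge and all labels distinct, P halts
   within C * n * (log2 n + 1) steps and outputs 1 in cell 0 iff the star is
   explorable. *)
Theorem theorem2 :
  exists (P : program) (C : nat),
    forall S : seq (seq nat), valid_instance3 S ->
      let n := star_nverts S in
      let s := run P (C * (n * (Nat.log2 n).+1)) (0, encode S) in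
      halted P s /\ (s.2 0 = 1%Z <-> explorable S).
Proof.
exists (compile 0 star_exp3), 100 => S vS n s.
(* The registers initially hold whatever the input has in their cells; [wp_init] allows any such
   content. *)
pose g r := encode S (reg r).
have ltL : size S < 2 ^ (Nat.log2 n).+1 by apply: ltnW; apply: ltn_exp_log2.
have [t [g' [h' [le_t Hsem out]]]] := wp_star_exp3 g vS ltL.
have at0 : code_at (compile 0 star_exp3) 0 (compile 0 star_exp3) by [].
have rep : represents (encode S) g (encode S) by [].
have [M R E] := compile_correct Hsem at0 rep.
have -> : s = (size (compile 0 star_exp3), M).
  by rewrite /s -(subnKC le_t) E size_compile -(size_compile 0) run_end.
by split; [apply: halted_end | rewrite /= R.2].
Qed.
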